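(* Let $F\colon\mathbf{Set}\to\mathbf{Set}$ be a functor with evaluation function $ev_F$ satisfying conditions (W1) and (W2). Then for every pseudometric space $(X,d)$ we have $K^F_d\le W^F_d$.
   Context: Fix $\top\in(0,\infty]$; pseudometrics take values in $[0,\top]$. $d_e$ is the Euclidean distance on $[0,\top]$ (with $d_e(a,\infty)=\infty$ for $a\ne\infty$, $d_e(\infty,\infty)=0$). An evaluation function for $F$ is $ev_F\colon F[0,\top]\to[0,\top]$; $\tilde Fg=ev_F\circ Fg$ for $g\colon X\to[0,\top]$. (W1): $f\le g$ (pointwise) implies $\tilde Ff\le\tilde Fg$. (W2): for every $t\in F([0,\top]^2)$, $d_e(ev_F(F\pi_1 t),ev_F(F\pi_2 t))\le\tilde Fd_e(t)$, $\pi_i$ the projections. Kantorovich distance: $K^F_d(t_1,t_2)=\sup\{d_e(\tilde Ff(t_1),\tilde Ff(t_2))\mid f\colon X\to[0,\top],\ d_e(f(x),f(x'))\le d(x,x')\}$. A coupling of $t_1,t_2\in FX$ is $t\in F(X\times X)$ with $F\pi_i(t)=t_i$; Wasserstein distance: $W^F_d(t_1,t_2)=\inf\{\tilde Fd(t)\mid t\text{ coupling of }t_1,t_2\}$, $\inf\emptyset=\top$. *)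

(* Defs.v *)
From mathcomp Require Import all_boot all_order all_algebra.
From mathcomp Require Import all_classical all_reals ereal.
From mathcomp Require Import lra.
Set Implicit Arguments.
Unset Strict Implicit.
Unset Printing Implicit Defensive.
Import Order.TTheory GRing.Theory Num.Theory.
Local Open Scope classical_set_scope.
Local Open Scope ereal_scope.

Record set_functor := SetFunctor {
  Fobj :> Type -> Type;
  Fmap : forall X Y : Type, (X -> Y) -> Fobj X -> Fobj Y;
  Fmap_id : forall X : Type, Fmap (@id X) = id;
  Fmap_comp : forall (X Y Z : Type) (g : Y -> Z) (f : X -> Y),
    Fmap (g \o f) = Fmap g \o Fmap f }.
Arguments Fmap F [X Y] f _ : rename.

Definition Itop (R : realType) (top : \bar R) := {x : \bar R | 0 <= x <= top}.

(* [`|a - b|] would be wrong here: the library's [+oo - +oo] is [-oo]. The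
   equations involving [-oo] are never used on [Itop top]. *)
Definition edist (R : realType) (a b : \bar R) : \bar R :=
  match a, b with
  | r%:E, s%:E => `|r - s|%:E
  | +oo, +oo | -oo, -oo => 0
  | _, _ => +oo
  end.

Lemma edist_itv (R : realType) (top : \bar R) (a b : Itop top) :
  0 <= edist (val a) (val b) <= top.
Proof.
case: a b => [a /= /andP[a0 at_]] [b /= /andP[b0 bt]].
case: a b a0 at_ b0 bt => [r| |] [s| |] //= a0 at_ b0 bt;
  rewrite ?lexx ?at_ ?bt ?le0y // ?(le_trans b0 bt) //.
case: top at_ bt => [t| |] // ; move: a0 b0;
  rewrite !lee_fin ?leey ?andbT ?normr_ge0 //= => r0 s0 rt st.
by rewrite ler_norml; apply/andP; split; lra.
Qed.

Definition d_e (R : realType) (top : \bar R) (a b : Itop top) : Itop top :=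
  exist _ (edist (val a) (val b)) (edist_itv a b).

Record is_pseudometric (R : realType) (top : \bar R) (X : Type)
    (d : X -> X -> Itop top) : Prop := IsPseudometric {
  pmetric_refl : forall x, val (d x x) = 0;
  pmetric_sym : forall x y, d x y = d y x;
  pmetric_triangle : forall x y z,
    val (d x z) <= val (d x y) + val (d y z) }.

Section Lifting.
Variables (R : realType) (top : \bar R).
Variables (F : set_functor) (ev : F (Itop top) -> Itop top).

Definition Ftilde (X : Type) (g : X -> Itop top) (t : F X) : Itop top :=
  ev (Fmap F g t).

Definition W1 : Prop := forall (X : Type) (f g : X -> Itop top),
  (forall x, val (f x) <= val (g x)) ->
  forall t : F X, val (Ftilde f t) <= val (Ftilde g t).

Definition W2 : Prop := forall t : F (Itop top * Itop top)%type,
  val (d_e (ev (Fmap F fst t)) (ev (Fmap F snd t)))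
    <= val (Ftilde (fun p => d_e p.1 p.2) t).

Definition nonexpansive (X : Type) (d : X -> X -> Itop top)
    (f : X -> Itop top) : Prop :=
  forall x x', val (d_e (f x) (f x')) <= val (d x x').

(* Constant functions are nonexpansive, so this is never [ereal_sup set0 = -oo]. *)
Definition kantorovich (X : Type) (d : X -> X -> Itop top) (t1 t2 : F X)
    : \bar R :=
  ereal_sup [set val (d_e (Ftilde f t1) (Ftilde f t2)) | f in nonexpansive d].

Definition couplings (X : Type) (t1 t2 : F X) : set (F (X * X)%type) :=
  [set t | Fmap F fst t = t1 /\ Fmap F snd t = t2].

(* The infimum is taken in [0, top], whereas [ereal_inf set0 = +oo]. *)
Definition wasserstein (X : Type) (d : X -> X -> Itop top) (t1 t2 : F X)
    : \bar R :=
  if couplings t1 t2 == set0 then top else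
  ereal_inf [set val (Ftilde (fun p => d p.1 p.2) t) | t in couplings t1 t2].

End Lifting.

(* Main.v *)
(** For a nonexpansive [f] and a coupling [t], apply (W2) to the image of [t]
    under [f * f], then bound [d_e (f x) (f y)] by [d x y] using (W1). *)
Require Import Defs.
From mathcomp Require Import all_boot all_order all_algebra.
From mathcomp Require Import all_classical all_reals ereal.
Local Open Scope ereal_scope.

(** A supremum lies below an infimum once each member of the first set lies below each member of the
    second; [edist_Ftilde_le_coupling] is this comparison for one [f] and one [t]. *)

Lemma Ftilde_comp (R : realType) (top : \bar R) (F : set_functor)
    (ev : F (Itop top) -> Itop top) (X Y : Type) (g : Y -> Itop top)
    (h : X -> Y) (t : F X) :
  Ftilde ev g (Fmap F h t) = Ftilde ev (g \o h) t.
Proof. by rewrite /Ftilde Fmap_comp. Qed.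

Lemma edist_Ftilde_le_coupling (R : realType) (top : \bar R) (F : set_functor)
    (ev : F (Itop top) -> Itop top) (hW1 : W1 ev) (hW2 : W2 ev)
    (X : Type) (d : X -> X -> Itop top) (f : X -> Itop top)
    (hf : nonexpansive d f) (t : F (X * X)%type) :
  val (d_e (Ftilde ev f (Fmap F fst t)) (Ftilde ev f (Fmap F snd t)))
    <= val (Ftilde ev (fun p => d p.1 p.2) t).
Proof.
have := hW2 (Fmap F (fun p : X * X => (f p.1, f p.2)) t).
(* Projecting after [f * f] is, by conversion, [f] after projecting, so the left sides now agree. *)
rewrite -/(Ftilde ev fst _) -/(Ftilde ev snd _) !Ftilde_comp.
move=> /Order.POrderTheory.le_trans; apply.
by apply: hW1 => p; apply: hf.
Qed.

Theorem theorem5p27 (R : realType) (top : \bar R) (top_gt0 : 0 < top)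
    (F : set_functor) (ev : F (Itop top) -> Itop top)
    (hW1 : W1 ev) (hW2 : W2 ev)
    (X : Type) (d : X -> X -> Itop top) (hd : is_pseudometric d)
    (t1 t2 : F X) :
  kantorovich ev d t1 t2 <= wasserstein ev d t1 t2.
Proof.
apply: ge_ereal_sup => _ [f hf <-]; rewrite /wasserstein; case: ifP => _.
  (* Without couplings the bound is [top], which no value of [d_e] exceeds. *)
  by have /andP[] := valP (d_e (Ftilde ev f t1) (Ftilde ev f t2)).
apply: le_ereal_inf_tmp => _ [t [<- <-] <-].
exact: edist_Ftilde_le_coupling.
Qed.
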